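(* Let $\mathcal X$ be a Banach lattice with order unit $\mathbf e$ and the norm induced by $\mathbf e$, and let $\mathcal Q\subset\mathcal X'$ be a non-empty, closed, convex set for which there is a closed subspace $\mathcal H_{\mathcal Q}\subset\mathcal X$ with $\mathcal Q=\mathcal H_{\mathcal Q}^\perp\cap\partial B'_+$. Then the weak$^*$ closure of $\mathfrak I(\mathcal H_{\mathcal Q})+\mathcal X''_-$ and the weak$^*$ closure of $\mathfrak H_{\mathcal Q}+\mathcal X''_-$ are both equal to $\mathfrak K_{\mathcal Q}$.
   Context: $\mathcal X$ is a real Banach lattice with an order unit $\mathbf e\in\mathcal X_+$ and norm $\|f\|_{\mathcal X}=\inf\{c\in\mathbb R: -c\,\mathbf e\le f\le c\,\mathbf e\}$. $\mathcal X'$ and $\mathcal X''$ are the topological dual and bidual with the induced dual orders; $\mathcal X''_-$ is the set of $\mathfrak n\in\mathcal X''$ with $\mathfrak n(\eta)\le0$ for all $\eta\in\mathcal X'_+$. $\mathfrak I:\mathcal X\to\mathcal X''$ is the canonical embedding. $\partial B'_+=\{\eta\in\mathcal X'_+:\eta(\mathbf e)=1\}$ is the positive part of the unit sphere of $\mathcal X'$. For a subset $A$ of a Banach space $\mathcal Z$, $A^\perp=\{\eta\in\mathcal Z':\eta(a)=0\ \forall a\in A\}$. $\mathfrak H_{\mathcal Q}=(\mathcal H_{\mathcal Q}^\perp)^\perp\subset\mathcal X''$ and $\mathfrak K_{\mathcal Q}=\{\mathfrak z\in\mathcal X'':\mathfrak z(\eta)\le0\ \forall\eta\in\mathcal Q\}$.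 The weak$^*$ topology on $\mathcal X''$ is $\sigma(\mathcal X'',\mathcal X')$. *)

(* Defs.v *)
From HB Require Import structures.
From mathcomp Require Import all_boot all_order all_algebra.
From mathcomp Require Import all_classical all_reals all_analysis.

Set Implicit Arguments.
Unset Strict Implicit.
Unset Printing Implicit Defensive.

Import Order.TTheory GRing.Theory Num.Theory.
Import numFieldNormedType.Exports.

Local Open Scope classical_set_scope.
Local Open Scope ring_scope.

(* A Banach lattice cannot be declared as the HB join of CompleteNormedModule
   and Order.Lattice: the hierarchy already has Num.RealDomain below both and
   no join of Zmodule and Lattice above it. The order [vle] and the lattice
   operations [vsup], [vinf] are therefore fields of the mixin. *)
HB.mixin Record isBanachLattice (R : realType) X
    & CompleteNormedModule R X := {
  vle : rel X ;
  vsup : X -> X -> X ;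
  vinf : X -> X -> X ;
  vle_refl : reflexive vle ;
  vle_anti : antisymmetric vle ;
  vle_trans : transitive vle ;
  vsupP : forall x y z, vle (vsup x y) z = vle x z && vle y z ;
  vinfP : forall x y z, vle z (vinf x y) = vle z x && vle z y ;
  vleD : forall x y z, vle x y -> vle (x + z) (y + z) ;
  vleZ : forall (c : R) x y, 0 <= c -> vle x y -> vle (c *: x) (c *: y) ;
  vle_norm : forall x y,
    vle (vsup x (- x)) (vsup y (- y)) -> `|x| <= `|y|
}.

#[short(type="banachLatticeType")]
HB.structure Definition BanachLattice (R : realType) :=
  {X of isBanachLattice R X & CompleteNormedModule R X}.

Definition vabs (R : realType) (X : banachLatticeType R) (x : X) : X :=
  vsup x (- x).

Definition order_unit (R : realType) (X : banachLatticeType R) (e : X) :=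
  vle 0 e /\ forall f : X, exists c : R, vle (vabs f) (c *: e).

Definition order_unit_norm (R : realType) (X : banachLatticeType R) (e f : X)
    : R :=
  inf [set c : R | vle (- (c *: e)) f /\ vle f (c *: e)].

Definition contlinear (R : realType) (V : normedModType R) : {pred V -> R} :=
  mem [set f : V -> R | linear f /\ continuous f].
Arguments contlinear {R} V.

Record dual (R : realType) (V : normedModType R) := Dual {
  dual_fun :> V -> R ;
  dual_funP : dual_fun \in contlinear V
}.

Section dual_lmodule.
Context (R : realType) (V : normedModType R).

HB.instance Definition _ := [isSub for @dual_fun R V].
HB.instance Definition _ := [Choice of dual V by <:].

Lemma contlinear_submod_closed : submod_closed (contlinear V).
Proof.
split=> [|a f g].
  rewrite inE; split => [b u v|]; last exact: cst_continuous.
  by rewrite /GRing.zero/= scaler0 addr0.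
rewrite !inE => -[lf cf] [lg cg]; split=> [b u v|].
  rewrite /= !fctE lf lg !scalerDr !scalerA [b * a]mulrC -!addrA.
  by congr (_ + _); rewrite addrCA.
by move=> x; apply: (@cvgD _ _ _ _ _ (a \*: f) g); [apply: cvgZl_tmp; exact: cf|exact: cg].
Qed.

HB.instance Definition _ := GRing.isSubmodClosed.Build _ _ (contlinear V)
  contlinear_submod_closed.
HB.instance Definition _ := [SubChoice_isSubLmodule of dual V by <:].

Lemma dual_linear (f : dual V) : linear f.
Proof. by have := dual_funP f; rewrite inE => -[]. Qed.

Lemma dual_continuous (f : dual V) : continuous f.
Proof. by have := dual_funP f; rewrite inE => -[]. Qed.

HB.instance Definition _ (f : dual V) :=
  GRing.isLinear.Build R V R *:%R f (@dual_linear f).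

Lemma dual_eqP (f g : dual V) : f =1 g <-> f = g.
Proof. by split=> [fg|-> //]; apply/val_inj/funext. Qed.

Lemma dualDE (f g : dual V) x : (f + g) x = f x + g x. Proof. by []. Qed.
Lemma dualZE a (f : dual V) x : (a *: f) x = a * f x. Proof. by []. Qed.
Lemma dual0E x : (0 : dual V) x = 0. Proof. by []. Qed.

End dual_lmodule.

Section dual_norm.
Context (R : realType) (V : normedModType R).
Implicit Types f g : dual V.

Definition dual_norm f : R :=
  sup [set `|f x| | x in [set x : V | `|x| <= 1]].

Lemma dual_norm_has_sup f :
  has_sup [set `|f x| | x in [set x : V | `|x| <= 1]].
Proof.
split; first by exists `|f 0|, 0 => //=; rewrite normr0.
have /linear_bounded_continuous/linear_boundedP := @dual_continuous _ _ f.
move=> /pinfty_ex_gt0[M M0 fM]; exists M => _ [x /= x1 <-].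
by rewrite (le_trans (fM x))// ler_piMr// ltW.
Qed.

Lemma dual_normP f x : `|f x| <= dual_norm f * `|x|.
Proof.
have [->|x0] := eqVneq x 0; first by rewrite linear0 !normr0 mulr0.
rewrite -ler_pdivrMr ?normr_gt0//.
apply: sup_upper_bound; first exact: dual_norm_has_sup.
exists (`|x|^-1 *: x); first by rewrite /= normfZV.
by rewrite linearZ normrM normfV normr_id mulrC.
Qed.

Lemma dual_norm_le f (M : R) :
  (forall x, `|x| <= 1 -> `|f x| <= M) -> dual_norm f <= M.
Proof.
move=> fM; apply: ge_sup; first by case: (dual_norm_has_sup f).
by move=> _ [x /= x1 <-]; exact: fM.
Qed.

Lemma dual_norm_ub f x : `|x| <= 1 -> `|f x| <= dual_norm f.
Proof.
by move=> x1; apply: sup_upper_bound; [exact: dual_norm_has_sup|exists x].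
Qed.

Lemma dual_norm_ge0 f : 0 <= dual_norm f.
Proof. by rewrite (le_trans (normr_ge0 (f 0)))// dual_norm_ub// normr0. Qed.

Lemma dual_normD f g : dual_norm (f + g) <= dual_norm f + dual_norm g.
Proof.
apply: dual_norm_le => x x1; rewrite dualDE.
by rewrite (le_trans (ler_normD _ _))// lerD// dual_norm_ub.
Qed.

Lemma dual_normZ (a : R) f : dual_norm (a *: f) = `|a| * dual_norm f.
Proof.
have le_ b g : dual_norm (b *: g) <= `|b| * dual_norm g.
  apply: dual_norm_le => x x1.
  by rewrite dualZE normrM ler_wpM2l// dual_norm_ub.
apply/eqP; rewrite eq_le le_/=.
have [->|a0] := eqVneq a 0; first by rewrite normr0 mul0r dual_norm_ge0.
rewrite -ler_pdivlMl ?normr_gt0// -normfV.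
by rewrite (le_trans _ (le_ a^-1 _))// scalerA mulVf// scale1r.
Qed.

Lemma dual_norm0_eq0 f : dual_norm f = 0 -> f = 0.
Proof.
move=> f0; apply/dual_eqP => x; apply/eqP; rewrite dual0E -normr_le0.
by rewrite (le_trans (dual_normP f x))// f0 mul0r.
Qed.

HB.instance Definition _ := @Lmodule_isNormed.Build R (dual V)
  dual_norm dual_normD dual_normZ dual_norm0_eq0.

End dual_norm.

Section bidual.
Context (R : realType) (V : normedModType R).

Lemma eval_contlinear (x : V) :
  (fun f : dual V => f x) \in contlinear (dual V).
Proof.
rewrite inE; have le_ : linear (fun f : dual V => f x) by move=> a f g.
split=> //.
pose ev : {linear dual V -> R} :=
  HB.pack (fun f : dual V => f x) (GRing.isLinear.Build _ _ _ _ _ le_).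
apply/(linear_bounded_continuous ev)/linear_boundedP.
exists `|x|; split=> [|r xr f]; first exact: num_real.
rewrite (le_trans (dual_normP f x))// mulrC ler_wpM2r ?dual_norm_ge0//.
exact: ltW.
Qed.

Definition bidual_embed (x : V) : dual (dual V) := Dual (eval_contlinear x).

End bidual.

Definition annihilator (R : realType) (V : normedModType R) (A : set V)
    : set (dual V) :=
  [set f | forall a, A a -> f a = 0].

(* sigma(W', W): the coarsest topology on W' making all evaluations
   f |-> f w continuous. *)
Definition weak_star (R : realType) (W : normedModType R) : Type :=
  sup_topology (fun w : W =>
    Topological.on (initial_topology (fun f : dual W => f w))).

HB.instance Definition _ (R : realType) (W : normedModType R) :=
  Topological.copy (weak_star W)
    (sup_topology (fun w : W =>
      Topological.on (initial_topology (fun f : dual W => f w)))).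

Lemma weak_star_cvgP (R : realType) (W : normedModType R)
    (F : set_system (weak_star W)) (f : weak_star W) : Filter F ->
  F --> f <-> forall w : W, (g : dual W) w @[g --> F] --> (f : dual W) w.
Proof.
move=> FF; split=> [Ff w|Ff].
  have /= := (proj1 (@cvg_sup (dual W) W (fun w : W =>
    Topological.on (initial_topology (fun f : dual W => f w))) F f _)) Ff w.
  move=> h A nA; apply: h.
  exact: (@initial_continuous (dual W) R (fun f : dual W => f w)).
apply/(@cvg_sup (dual W) W (fun w : W =>
    Topological.on (initial_topology (fun f : dual W => f w))) F f _) => w.
move=> A [/= B [[C oC <-] Cf] CA].
apply: (filterS CA); apply: (Ff w).
by apply: open_nbhs_nbhs.
Qed.

Definition weak_star_closure (R : realType) (W : normedModType R)
    (A : set (dual W)) : set (dual W) :=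
  @closure (weak_star W) A.

Definition set_add (V : zmodType) (A B : set V) : set V :=
  [set a + b | a in A & b in B].

Section positivity.
Context (R : realType) (X : banachLatticeType R).

Definition dual_pos : set (dual X) :=
  [set eta | forall x : X, vle 0 x -> 0 <= eta x].

Definition bidual_neg : set (dual (dual X)) :=
  [set n | forall eta, dual_pos eta -> n eta <= 0].

(* By positivity of eta, eta e is the dual norm of eta when X carries the
   order unit norm of e. *)
Definition pos_sphere (e : X) : set (dual X) :=
  [set eta | dual_pos eta /\ eta e = 1].

End positivity.
Arguments dual_pos {R} X.
Arguments bidual_neg {R} X.

Definition polar_cone (R : realType) (W : normedModType R) (Q : set W)
    : set (dual W) :=
  [set z | forall eta, Q eta -> z eta <= 0].

(* Main.v *)
Require Import Defs.
From mathcomp Require Import all_boot all_order all_algebra.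
From mathcomp Require Import all_classical all_reals all_analysis.
From mathcomp Require Import lra.
Import Order.TTheory GRing.Theory Num.Theory.
Import numFieldNormedType.Exports.
Local Open Scope classical_set_scope.
Local Open Scope ring_scope.

(** The inclusions of both closures in the polar cone of [Q] hold because the
    polar cone is weak* closed and contains both sums. As the embedded [H] lies
    in its bi-annihilator, it remains to approximate every [z] of the polar cone
    by elements of [C], the sum of the embedded [H] and the negative bidual
    cone.

    [C] is a convex cone, so the weak* bipolar theorem ([weak_star_bipolar])
    reduces this to showing [z eta <= 0] for each [eta] in the predual on which
    [C] is nonpositive. Testing [eta] on the subspace [H] shows that [eta]
    annihilates [H], and testing it on the embedded negative elements of [X]
    shows that it is positive. If [eta e > 0], then [eta] normalised by [eta e]
    belongs to [Q], hence [z eta <= 0]; if [eta e = 0], then [eta] vanishes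
    because the multiples of [e] dominate everything ([dual_pos_unit0]).

    The bipolar theorem is a finite-dimensional matter: a basic weak*
    neighbourhood of [z] only constrains finitely many evaluations, so if one
    of them misses [C], the image of [C] in a space of row vectors is a convex
    cone at positive distance from the image of [z]. A linear form separating
    the two ([cone_separation_rV]) has coordinates that define a separating
    combination of the evaluation points. The linear form is obtained as in the
    Hahn-Banach theorem, by lowering the distance to the cone, a sublinear
    functional, until it is linear in every coordinate direction; in finite
    dimension finitely many lowering steps suffice. *)

(** * Sublinear functionals *)

Definition convex_cone {R : realType} {V : lmodType R} (A : set V) : Prop :=
  [/\ A 0, forall x y, A x -> A y -> A (x + y) &
      forall (t : R) x, 0 <= t -> A x -> A (t *: x)].

Definition sublinear {R : realType} {V : lmodType R} (p : V -> R) : Prop :=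
  (forall x y, p (x + y) <= p x + p y) /\
  (forall (t : R) x, 0 <= t -> p (t *: x) <= t * p x).

Lemma sublinear0 {R : realType} {V : lmodType R} (p : V -> R) :
  sublinear p -> p 0 = 0.
Proof.
move=> [pD pZ]; apply/eqP; rewrite eq_le.
have := pZ 0 0 (lexx _); rewrite scale0r mul0r => ->/=.
by have := pD 0 0; rewrite addr0; lra.
Qed.

Lemma sublinearN_ge {R : realType} {V : lmodType R} (p : V -> R) x :
  sublinear p -> - p x <= p (- x).
Proof.
move=> sp; have [pD _] := sp; have := pD x (- x).
by rewrite subrr sublinear0//; lra.
Qed.

Lemma sublinear_scale {R : realType} {V : lmodType R} (p : V -> R) (t : R) x :
  sublinear p -> 0 <= t -> p (t *: x) = t * p x.
Proof.
move=> sp; have [_ pZ] := sp; rewrite le_eqVlt => /predU1P[<-|t0].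
  by rewrite scale0r mul0r sublinear0.
apply/eqP; rewrite eq_le pZ ?(ltW t0)//= -(ler_pdivlMl _ _ t0).
have := pZ t^-1 (t *: x); rewrite scalerA mulVf ?gt_eqF// scale1r; apply.
by rewrite invr_ge0 ltW.
Qed.

(** Infimal convolution of [p] with a set [S] of pairs (direction, cost). With
    all costs zero and [S] given by the opposite of a cone, it is the
    [p]-distance to that cone; with [S] a ray in the direction [u], it is the
    lowering step of the Hahn-Banach argument. *)
Definition inf_conv {R : realType} {V : lmodType R} (p : V -> R)
    (S : set (V * R^o)%type) (x : V) : R :=
  inf [set p (x + c.1) + c.2 | c in S].

Lemma inf_conv_has_inf {R : realType} {V : lmodType R} (p : V -> R)
    (S : set (V * R^o)%type) x :
  sublinear p -> convex_cone S -> (forall c, S c -> 0 <= p c.1 + c.2) ->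
  has_inf [set p (x + c.1) + c.2 | c in S].
Proof.
move=> sp [S0 _ _] S_ge0; split; first by exists (p (x + 0) + 0), 0.
exists (- p (- x)) => _ [c Sc <-].
have [pD _] := sp; have := pD (- x) (x + c.1).
by rewrite addKr; have := S_ge0 _ Sc; lra.
Qed.

Lemma inf_conv_le {R : realType} {V : lmodType R} (p : V -> R)
    (S : set (V * R^o)%type) x c :
  sublinear p -> convex_cone S -> (forall c, S c -> 0 <= p c.1 + c.2) ->
  S c -> inf_conv p S x <= p (x + c.1) + c.2.
Proof.
move=> sp cS S_ge0 Sc; apply: ge_inf; last by exists c.
by have [] := inf_conv_has_inf p S x sp cS S_ge0.
Qed.

(** Positive homogeneity and subadditivity pass from [p] to the infimum because
    [S] is stable under scaling and sums; nonnegativity of [p] plus cost on [S]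
    is what keeps the infimum finite. *)
Lemma sublinear_inf_conv {R : realType} {V : lmodType R} (p : V -> R)
    (S : set (V * R^o)%type) :
  sublinear p -> convex_cone S -> (forall c, S c -> 0 <= p c.1 + c.2) ->
  sublinear (inf_conv p S).
Proof.
move=> sp cS S_ge0; have [pD pZ] := sp; have [S0 SD SZ] := cS.
have inf_n0 x : [set p (x + c.1) + c.2 | c in S] !=set0.
  by have [] := inf_conv_has_inf p S x sp cS S_ge0.
split=> [x y|t x t0].
  rewrite -lerBlDr; apply: lb_le_inf => // _ [c Sc <-].
  rewrite lerBlDr -lerBlDl; apply: lb_le_inf => // _ [d Sd <-].
  rewrite lerBlDl.
  have := inf_conv_le p S (x + y) _ sp cS S_ge0 (SD _ _ Sc Sd).
  have := pD (x + c.1) (y + d.1); rewrite addrACA /=; lra.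
have [->|tn0] := eqVneq t 0.
  have := inf_conv_le p S (0 *: x) _ sp cS S_ge0 S0.
  by rewrite mul0r scale0r /= !addr0 (sublinear0 p sp).
have {tn0} t0' : 0 < t by rewrite lt_neqAle eq_sym tn0.
rewrite -ler_pdivrMl//; apply: lb_le_inf => // _ [c Sc <-].
rewrite ler_pdivrMl//.
apply: le_trans (inf_conv_le p S (t *: x) _ sp cS S_ge0 (SZ t _ t0 Sc)) _.
by rewrite /= -scalerDr mulrDr lerD2r pZ.
Qed.

(** The functional is the infimum over [t >= 0] of [p (x + t *: u) - t * p u];
    evaluating at [x = - u] and [t = 1] bounds [q (- u)]. Since [- q u] is at
    most [q (- u)] and [- p u] at most [- q u], the functional [q] agrees with
    [p] at [u] and is linear on the line spanned by [u]. *)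
Lemma sublinear_linearize {R : realType} {V : lmodType R} (p : V -> R) u :
  sublinear p ->
  exists q : V -> R, [/\ sublinear q, forall x, q x <= p x & q (- u) <= - p u].
Proof.
move=> sp.
pose S := [set (t *: u, - (t * p u) : R^o) | t in [set t : R | 0 <= t]].
have cS : convex_cone S.
  split=> [|_ _ [a /= a0 <-] [b /= b0 <-]|t _ t0 [a /= a0 <-]].
  - by exists 0; [exact: lexx|rewrite scale0r mul0r oppr0].
  - exists (a + b); first exact: addr_ge0.
    by rewrite scalerDl mulrDl opprD.
  - exists (t * a); first exact: mulr_ge0.
    by congr (_, _); rewrite ?scalerA// /GRing.scale/= mulrN mulrA.
have S_ge0 c : S c -> 0 <= p c.1 + c.2.
  by move=> [t /= t0 <-] /=; rewrite sublinear_scale// subrr.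
exists (inf_conv p S); split=> [|x|].
- exact: sublinear_inf_conv.
- have [S0 _ _] := cS.
  by have := inf_conv_le p S x _ sp cS S_ge0 S0; rewrite /= !addr0.
- have S1 : S (u, - p u) by exists 1; [exact: ler01|rewrite scale1r mul1r].
  have := inf_conv_le p S (- u) _ sp cS S_ge0 S1.
  by rewrite /= addNr (sublinear0 p sp) add0r.
Qed.

(** Linearity in a direction is inherited by every smaller sublinear functional,
    so that directions can be treated one after the other. *)
Lemma sublinear_linearize_seq {R : realType} {V : lmodType R} (p : V -> R)
    (s : seq V) :
  sublinear p ->
  exists q : V -> R, [/\ sublinear q, forall x, q x <= p x &
    {in s, forall u, q (- u) <= - q u}].
Proof.
move=> sp; elim: s => [|u s [q [sq qp qs]]]; first by exists p.
have [r [sr rq ru]] := sublinear_linearize q u sq.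
exists r; split=> // [x|w]; first exact: le_trans (rq x) (qp x).
rewrite inE => /predU1P[->|ws]; first by rewrite (le_trans ru)// lerN2.
by rewrite (le_trans (rq _))// (le_trans (qs _ ws))// lerN2.
Qed.

(** Hahn-Banach in finite dimension: a sublinear functional dominates a linear
    form that reaches it at a prescribed point [v]. Lowering in the direction
    [v] comes first, to protect the value at [v]; lowering along the canonical
    basis then leaves a linear form. *)
Lemma sublinear_rV_linear {R : realType} {n : nat} (p : 'rV[R]_n -> R)
    (v : 'rV[R]_n) :
  sublinear p ->
  exists a : 'I_n -> R,
    (forall x : 'rV[R]_n, \sum_i x 0 i * a i <= p x) /\ p v <= \sum_i v 0 i * a i.
Proof.
move=> sp; have [r [sr rp rv]] := sublinear_linearize p v sp.
have [q [sq qr qE]] :=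
  sublinear_linearize_seq r [seq delta_mx 0 i | i : 'I_n] sr.
pose a i := q (delta_mx 0 i).
have qZ t i : q (t *: delta_mx 0 i) <= t * a i.
  have [t0|/ltW t0] := leP 0 t; first by rewrite sublinear_scale.
  rewrite -[t in t *: _]opprK scaleNr -scalerN sublinear_scale ?oppr_ge0//.
  by rewrite -[leRHS]mulrNN ler_wpM2l ?oppr_ge0// qE// map_f// mem_enum.
have q_le x : q x <= \sum_i x 0 i * a i.
  rewrite [in q x](row_sum_delta x).
  elim/big_ind2 : _ => // [|y b z c yb zc]; first by rewrite sublinear0.
  by have [qD _] := sq; rewrite (le_trans (qD _ _))// lerD.
(* The form dominates [q]; oddness turns this into the reverse bound
   [- q (- x)], which is in turn at most [q x]. *)
have aN (x : 'rV[R]_n) : \sum_i (- x) 0 i * a i = - \sum_i x 0 i * a i.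
  by rewrite -sumrN; apply: eq_bigr => i _; rewrite mxE mulNr.
exists a; split=> [x|].
  rewrite (le_trans _ (rp x))// (le_trans _ (qr x))//.
  have := q_le (- x); rewrite aN.
  by have := sublinearN_ge q (- x) sq; rewrite opprK; lra.
have := q_le v; have := sublinearN_ge q (- v) sq; rewrite opprK.
by have := qr (- v); lra.
Qed.

(** * Separation and the weak* bipolar theorem *)

(** The linear form is dominated by the distance to [K] in the sum norm and
    reaches it at [v]: it is positive at [v], where the distance is at least
    [d], and nonpositive on [K], where the distance vanishes. *)
Lemma cone_separation_rV {R : realType} {n : nat} (K : set 'rV[R]_n)
    (v : 'rV[R]_n) (d : R) :
  convex_cone K -> 0 < d ->
  (forall c, K c -> d <= \sum_i `|v 0 i - c 0 i|) ->
  exists a : 'I_n -> R, 0 < \sum_i v 0 i * a i /\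
    forall c, K c -> \sum_i c 0 i * a i <= 0.
Proof.
move=> cK d0 gap; have [K0 KD KZ] := cK.
pose N (x : 'rV[R]_n) := \sum_i `|x 0 i|.
have sN : sublinear N.
  split=> [x y|t x t0].
    by rewrite -big_split/=; apply: ler_sum => i _; rewrite mxE ler_normD.
  rewrite mulr_sumr; apply: ler_sum => i _.
  by rewrite mxE normrM ger0_norm.
pose S := [set (- c, 0 : R^o) | c in K].
have cS : convex_cone S.
  split=> [|_ _ [x Kx <-] [y Ky <-]|t _ t0 [x Kx <-]].
  - by exists 0 => //; rewrite oppr0.
  - by exists (x + y); [exact: KD|rewrite opprD -[in LHS](addr0 0)].
  - by exists (t *: x); [exact: KZ|rewrite -scalerN -[in LHS](scaler0 _ t)].
have S_ge0 c : S c -> 0 <= N c.1 + c.2.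
  by move=> [x Kx <-] /=; rewrite addr0 sumr_ge0.
have [a [aN va]] :=
  sublinear_rV_linear (inf_conv N S) v (sublinear_inf_conv N S sN cS S_ge0).
exists a; split=> [|c Kc].
  rewrite (lt_le_trans d0)// (le_trans _ va)//.
  apply: lb_le_inf; first by have [] := inf_conv_has_inf N S v sN cS S_ge0.
  move=> _ [_ [c Kc <-] <-]; rewrite addr0 (le_trans (gap c Kc))//.
  by apply: ler_sum => i _; rewrite !mxE.
rewrite (le_trans (aN c))//.
have Sc : S (- c, 0) by exists c.
by have := inf_conv_le N S c _ sN cS S_ge0 Sc; rewrite /= subrr (sublinear0 N sN) addr0.
Qed.

(** The sets of points of [A] that are [d]-close to [z] on a finite sequence [s]
    generate a filter converging pointwise, that is weak*, to [z]; the
    hypothesis says that this filter is proper. *)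
Lemma weak_star_closure_approx {R : realType} {W : normedModType R}
    (A : set (dual W)) (z : dual W) :
  (forall (s : seq W) (d : R), 0 < d ->
    exists g, A g /\ {in s, forall w, `|z w - g w| < d}) ->
  weak_star_closure A z.
Proof.
move=> approx.
pose B (sd : seq W * R) : set (weak_star W) :=
  [set g : dual W | A g /\ {in sd.1, forall w, `|z w - g w| < sd.2}].
pose F := filter_from [set sd : seq W * R | 0 < sd.2] B.
have FF : Filter F.
  apply: filter_from_filter; first by exists ([::], 1) => /=.
  move=> [s d] [s' d'] /= d0 d0'; exists (s ++ s', Num.min d d').
    by rewrite /= lt_min d0.
  move=> g [Ag gd]; split; split=> //= w ws; have := gd w.
  - by rewrite mem_cat ws lt_min => /(_ isT)/andP[].
  - by rewrite mem_cat ws orbT lt_min => /(_ isT)/andP[].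
have Fz : F --> (z : weak_star W).
  apply/weak_star_cvgP => w; apply/cvgrPdist_lt => d d0.
  exists ([:: w], d) => // g [_ gd] /=.
  by apply: gd; rewrite mem_head.
move=> U /Fz [[s d] /= d0 BU].
have [g [Ag gd]] := approx s d d0.
by exists g; split=> //; apply: BU.
Qed.

Lemma weak_star_closure_le {R : realType} {W : normedModType R}
    (A : set (dual W)) (z : dual W) w :
  weak_star_closure A z -> (forall g, A g -> g w <= 0) -> z w <= 0.
Proof.
move=> Az A_le0; rewrite leNgt; apply/negP => z0.
have /weak_star_cvgP/(_ w) := @cvg_id _ (nbhs (z : weak_star W)).
move=> /cvgrPdist_lt/(_ _ z0)/Az[g [Ag]] /=.
have := A_le0 g Ag.
by rewrite ltr_norml => g0 /andP[_]; lra.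
Qed.

(** If some finite sequence [s] and [d > 0] defeat the approximation, then the
    vector of evaluations at [s] sends [C] to a convex cone that stays at
    distance [d] from the image of [z]; a separating linear form gives a
    combination [w] of [s] at which [z] is positive while [C] is nonpositive. *)
Lemma weak_star_bipolar {R : realType} {W : normedModType R}
    (C : set (dual W)) (z : dual W) :
  convex_cone C ->
  (forall w, (forall g, C g -> g w <= 0) -> z w <= 0) ->
  weak_star_closure C z.
Proof.
move=> [C0 CD CZ] zC; apply: weak_star_closure_approx => s d d0.
apply: contrapT => no_approx.
pose T (g : dual W) : 'rV[R]_(size s) := \row_i g s`_i.
have cTC : convex_cone (T @` C).
  split=> [|_ _ [f Cf <-] [g Cg <-]|t _ t0 [f Cf <-]].
  - by exists 0 => //; apply/rowP => i; rewrite !mxE dual0E.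
  - by exists (f + g); [exact: CD|apply/rowP => i; rewrite !mxE].
  - by exists (t *: f); [exact: CZ|apply/rowP => i; rewrite !mxE].
have gap c : (T @` C) c -> d <= \sum_i `|T z 0 i - c 0 i|.
  move=> [g Cg <-]; rewrite leNgt; apply/negP => lt_d; apply: no_approx.
  exists g; split=> // w ws; apply: le_lt_trans lt_d.
  have ws' : (index w s < size s)%N by rewrite index_mem.
  rewrite (bigD1 (Ordinal ws'))//= !mxE /= nth_index// lerDl.
  by rewrite sumr_ge0.
have [a [za aC]] := cone_separation_rV _ _ _ cTC d0 gap.
have evalE (g : dual W) :
    g (\sum_(i < size s) a i *: s`_i) = \sum_i T g 0 i * a i.
  rewrite linear_sum; apply: eq_bigr => i _.
  by rewrite linearZ mxE mulrC.
have := zC (\sum_i a i *: s`_i).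
rewrite evalE leNgt za => /(_ _)/negP; apply=> // g Cg.
by rewrite evalE aC//; exists g.
Qed.

(** * Positive functionals and the order unit *)

(** Each [x] lies between [- (c *: e)] and [c *: e] for some [c], and a positive
    functional preserves these inequalities. *)
Lemma dual_pos_unit0 {R : realType} {X : banachLatticeType R} (e : X)
    (eta : dual X) :
  order_unit e -> dual_pos X eta -> eta e = 0 -> eta = 0.
Proof.
move=> [_ e_dom] eta_pos eta_e.
have eta_le x y : vle x y -> eta x <= eta y.
  move=> /(vleD _ _ (- x)); rewrite subrr => /eta_pos.
  by rewrite linearB subr_ge0.
apply/dual_eqP => x; rewrite dual0E.
have [c] := e_dom x; rewrite /vabs vsupP => /andP[/eta_le + /eta_le].
by rewrite linearZ linearN /= eta_e; lra.
Qed.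

Theorem lemma3p5 (R : realType) (X : banachLatticeType R) (e : X)
  (e_unit : order_unit e)
  (norm_e : forall f : X, `|f| = order_unit_norm e f)
  (Q : set (dual X))
  (Q_neq0 : Q !=set0)
  (Q_closed : closed Q)
  (Q_convex : convex_set (Q : set (convex_lmodType (dual X))))
  (H : set X)
  (H_closed : closed H)
  (H_submod : submod_closed (mem H))
  (QE : Q = annihilator H `&` pos_sphere e) :
  weak_star_closure (set_add (@bidual_embed R X @` H) (bidual_neg X))
    = polar_cone Q /\
  weak_star_closure (set_add (annihilator (annihilator H)) (bidual_neg X))
    = polar_cone Q.
Proof.
have [H0 HL] := H_submod; rewrite inE in H0.
have HZ t x : H x -> H (t *: x).
  by move=> Hx; have := HL t x 0; rewrite !inE addr0; apply.
have HD x y : H x -> H y -> H (x + y).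
  by move=> Hx Hy; have := HL 1 x y; rewrite !inE scale1r; apply.
set A := set_add _ _; set B := set_add (annihilator _) _.
have AB : A `<=` B.
  move=> _ [_ [h Hh <-] [n n_neg <-]].
  by exists (bidual_embed h); [move=> eta /(_ h Hh)|exists n].
have B_le : weak_star_closure B `<=` polar_cone Q.
  move=> z Bz eta; rewrite QE => -[H_eta [eta_pos _]].
  apply: weak_star_closure_le Bz _ => _ [f f_ann [n n_neg <-]].
  by rewrite dualDE f_ann// add0r n_neg.
have A_ge : polar_cone Q `<=` weak_star_closure A.
  move=> z zQ; apply: weak_star_bipolar => [|eta eta_polar].
    split=> [|_ _ [_ [h Hh <-] [m mneg <-]] [_ [k Hk <-] [n nneg <-]]|].
    - exists (bidual_embed 0); first by exists 0.
      exists 0; first by move=> eta _; rewrite dual0E.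
      by apply/dual_eqP => eta; rewrite dualDE dual0E addr0 /= linear0.
    - exists (bidual_embed (h + k)); first by exists (h + k) => //; exact: HD.
      exists (m + n).
        by move=> eta eta_pos; rewrite dualDE -oppr_ge0 opprD addr_ge0//
          oppr_ge0 ?mneg ?nneg.
      apply/dual_eqP => eta; rewrite !dualDE /= linearD; lra.
    - move=> t _ t0 [_ [h Hh <-] [m mneg <-]].
      exists (bidual_embed (t *: h)); first by exists (t *: h) => //; exact: HZ.
      exists (t *: m).
        by move=> eta eta_pos; rewrite dualZE mulr_ge0_le0// mneg.
      by apply/dual_eqP => eta; rewrite dualZE !dualDE dualZE /= linearZ mulrDr.
  have eta_H_le h : H h -> eta h <= 0.
    move=> Hh; have := eta_polar (bidual_embed h); apply.
    exists (bidual_embed h); first by exists h.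
    by exists 0; [move=> x _; rewrite dual0E|rewrite addr0].
  have eta_H : annihilator H eta.
    move=> h Hh; apply/eqP; rewrite eq_le eta_H_le//=.
    have := eta_H_le _ (HZ (-1) h Hh).
    by rewrite scaleN1r linearN oppr_le0.
  have eta_pos : dual_pos X eta.
    move=> x x0; have := eta_polar (bidual_embed (- x)).
    rewrite /= linearN oppr_le0; apply.
    exists (bidual_embed 0); first by exists 0.
    exists (bidual_embed (- x)).
      by move=> f f_pos; rewrite /= linearN oppr_le0 f_pos.
    by apply/dual_eqP => f; rewrite dualDE /= linear0 add0r.
  have eta_e_ge0 : 0 <= eta e by apply: eta_pos; case: e_unit.
  have [eta_e0|eta_e_neq0] := eqVneq (eta e) 0.
    by rewrite (dual_pos_unit0 _ _ e_unit eta_pos eta_e0) linear0.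
  have eta_e_gt0 : 0 < eta e by rewrite lt_neqAle eq_sym eta_e_neq0.
  have := zQ ((eta e)^-1 *: eta).
  rewrite linearZ /= pmulr_rle0 ?invr_gt0//; apply.
  rewrite QE; split; first by move=> h Hh; rewrite dualZE (eta_H h Hh) mulr0.
  split; last by rewrite dualZE mulVf.
  by move=> x x0; rewrite dualZE mulr_ge0 ?invr_ge0// eta_pos.
have clAB : weak_star_closure A `<=` weak_star_closure B.
  exact: (@closureS (weak_star (dual X)) A B AB).
by split; apply/seteqP; split=> z; [move/clAB/B_le|move/A_ge|
  move/B_le|move/A_ge/clAB].
Qed.
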